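(* For every integer $s$ there is a constant $c=c(s)$ such that for all integers $k\ge 3$ and all $n\ge 2$, $r_k(K_s,P_n) \le {\rm twr}_{k-2}\left(2^{c(\log n)^{s-1}}\right)$.
   Context: For ordered $k$-uniform hypergraphs $G,H$, the ordered Ramsey number $r_k(G,H)$ is the minimum $N$ such that every red/blue coloring of the $k$-element subsets of $[N]=\{1,\dots,N\}$ contains a red copy of $G$ or a blue copy of $H$, where copies are order-preserving embeddings. $K_s=K_s^{(k)}$ is the complete $k$-uniform hypergraph on $s$ vertices. The monotone path $P_n=P_n^{(k)}$ is the ordered $k$-uniform hypergraph on $\{1,\dots,n\}$ with the $n-k+1$ edges $\{i,i+1,\dots,i+k-1\}$, $i=1,\dots,n-k+1$. The tower function is defined by ${\rm twr}_1(x)=x$ and ${\rm twr}_{i+1}(x)=2^{{\rm twr}_i(x)}$. Logarithms are base $2$. *)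

(* Defs.v *)
From mathcomp Require Import all_boot all_order all_algebra.
From mathcomp Require Import all_classical all_reals all_analysis.

Set Implicit Arguments.
Unset Strict Implicit.
Unset Printing Implicit Defensive.

Import Order.TTheory GRing.Theory Num.Theory.
Local Open Scope ring_scope.

(* The vertex set {1, ..., m} is represented by 'I_m = {0, ..., m - 1} with its
   natural order. *)
Record ordered_hypergraph (k : nat) := OrderedHypergraph {
  nb_vertices : nat;
  edges : {set {set 'I_nb_vertices}};
  edges_uniform : forall e, e \in edges -> #|e| = k
}.

(* A red/blue coloring of the k-subsets of [N] is represented by a function
   chi on all subsets; only its values on k-subsets are ever used, since
   embeddings are injective and the edges of G have size k. *)
Definition mono_copy (k N : nat) (G : ordered_hypergraph k)
    (chi : {set 'I_N} -> bool) (color : bool) : Prop :=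
  exists f : 'I_(nb_vertices G) -> 'I_N,
    (forall i j : 'I_(nb_vertices G), (i < j)%N -> (f i < f j)%N) /\
    (forall e : {set 'I_(nb_vertices G)}, e \in edges G -> chi (f @: e) = color).

(* The color true is red and false is blue. *)
Definition ordered_arrow (k : nat) (G H : ordered_hypergraph k) (N : nat)
    : Prop :=
  forall chi : {set 'I_N} -> bool, mono_copy G chi true \/ mono_copy H chi false.

Definition is_ordered_ramsey (k : nat) (G H : ordered_hypergraph k) (N : nat)
    : Prop :=
  ordered_arrow G H N /\ (forall M, ordered_arrow G H M -> (N <= M)%N).

Definition complete_edges (k s : nat) : {set {set 'I_s}} :=
  [set e : {set 'I_s} | #|e| == k].

Lemma complete_edges_uniform (k s : nat) (e : {set 'I_s}) :
  e \in complete_edges k s -> #|e| = k.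
Proof. by rewrite inE => /eqP. Qed.

Definition complete_hypergraph (k s : nat) : ordered_hypergraph k :=
  OrderedHypergraph (@complete_edges_uniform k s).

Definition path_edge (k n i : nat) : {set 'I_n} :=
  [set j : 'I_n | (i <= j < i + k)%N].

Definition path_edges (k n : nat) : {set {set 'I_n}} :=
  [set path_edge k n i | i : 'I_n.+1 & (i + k <= n)%N].

Lemma path_edges_uniform (k n : nat) (e : {set 'I_n}) :
  e \in path_edges k n -> #|e| = k.
Proof.
case/imsetP => i; rewrite inE => le_ikn ->.
have lt_n (j : 'I_k) : (i + j < n)%N.
  by apply: leq_trans le_ikn; rewrite ltn_add2l.
pose f (j : 'I_k) := Ordinal (lt_n j).
have f_inj : injective f by move=> a b [] /addnI /val_inj.
suff -> : path_edge k n i = f @: [set: 'I_k].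
  by rewrite card_imset // cardsT card_ord.
apply/setP => j; rewrite !inE; apply/idP/imsetP => [/andP[le_ij lt_j]|[a _ ->]].
  have lt_jk : (j - i < k)%N by rewrite ltn_subLR.
  by exists (Ordinal lt_jk) => //; apply: val_inj; rewrite /= subnKC.
by rewrite /= leq_addr ltn_add2l ltn_ord.
Qed.

Definition monotone_path (k n : nat) : ordered_hypergraph k :=
  OrderedHypergraph (@path_edges_uniform k n).

(* twr 1 x = x and twr i.+1 x = 2 ^ twr i x for i >= 1; twr 0 is meaningless. *)
Definition twr (R : realType) (i : nat) (x : R) : R :=
  iter i.-1 (fun y : R => 2 `^ y) x.

Definition log2 (R : realType) (x : R) : R := ln x / ln 2.

(* Main.v *)
Require Import Defs.
From mathcomp Require Import all_classical all_reals all_analysis.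
(* Last, so that [set0] and the like are those of finite sets. *)
From mathcomp Require Import all_boot all_order all_algebra zify.

(** For k = 3, give a pair x < y the label l(x, y), the length of a longest
    blue tight path ending in (x, y). With no blue P_n there are fewer than n
    labels, and x < y < z is red as soon as l(y, z) <= l(x, y); so it suffices
    to find a clique that is descending in this sense. Suppose S has no
    descending s-clique with labels in an interval I, and let c be the
    midpoint of I. If v sends labels of I that are >= c to all of S', then S'
    has no descending (s-1)-clique with labels of I that are <= c; dually, if
    S' sends labels of I that are <= c to some w, then S' has none with labels
    of I that are >= c. One of the two happens for a large part S' of S, and I
    is replaced by its two halves, for one of which s has dropped by one.
    Starting from the interval of all labels there are only O((log n)^(s-2))
    such replacements before no pair is left.

    The Erdos-Rado argument passes from k to k + 1 at the cost of one
    exponential. If k > s, then K_s has no edge, so only finitely many k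
    matter for the constant. *)

Set Implicit Arguments.
Unset Strict Implicit.
Unset Printing Implicit Defensive.

Import Order.TTheory GRing.Theory Num.Theory.

Lemma leq_expn2r m n k : m <= n -> m ^ k <= n ^ k.
Proof. by move=> mn; case: k => // k; rewrite leq_exp2r. Qed.

(** * Descending cliques *)

Definition asymmetric (T : Type) (r : rel T) : Prop :=
  forall x y, r x y -> ~~ r y x.

Lemma asym_irreflexive (T : Type) (r : rel T) : asymmetric r -> irreflexive r.
Proof.
by move=> r_asym x; apply/negP => rxx; have := r_asym _ _ rxx; rewrite rxx.
Qed.

Section DescendingCliques.
Variables (T : finType) (L : Type) (lt : rel T) (le : rel L) (l : T -> T -> L).
Hypothesis lt_asym : asymmetric lt.
Implicit Types (P Q : pred L) (c : L) (S X : {set T}) (t : nat).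

Definition descending P X : Prop :=
  {in X &, forall x y, lt x y -> P (l x y)} /\
  {in X & &, forall x y z, lt x y -> lt y z -> le (l y z) (l x y)}.

Definition clique_free P t S : Prop :=
  forall X, X \subset S -> #|X| = t -> ~ descending P X.

Definition upper_nbhd P c S (v : T) : {set T} :=
  [set y in S | [&& lt v y, P (l v y) & le c (l v y)]].

Definition lower_nbhd P c S (v : T) : {set T} :=
  [set x in S | [&& lt x v, P (l x v) & le (l x v) c]].

Lemma clique_freeW P Q t S S' :
  S' \subset S -> subpred Q P -> clique_free P t S -> clique_free Q t S'.
Proof.
move=> S'S QP freeS X XS' cardX [QX descX].
apply: (freeS X (subset_trans XS' S'S) cardX); split=> // x y xX yX xy.
exact/QP/QX.
Qed.

Lemma clique_free1_eq0 P S : clique_free P 1 S -> S = set0.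
Proof.
move=> freeS; have [//|[x xS]] := set_0Vmem S.
case: (freeS [set x] _ (cards1 x)); first by rewrite sub1set.
by split=> [y z /set1P-> /set1P->|y z w /set1P-> /set1P->];
  rewrite asym_irreflexive.
Qed.

Lemma clique_free_upper_nbhd P c t S v : transitive le -> v \in S ->
  clique_free P t.+1 S ->
  clique_free [pred i | P i && le i c] t (upper_nbhd P c S v).
Proof.
move=> le_trans vS freeS X XU cardX [PX descX].
have XP y : y \in X -> [/\ y \in S, lt v y, P (l v y) & le c (l v y)].
  by move/(subsetP XU); rewrite inE => /and4P[].
have not_lt_v x : x \in v |: X -> ~~ lt x v.
  by case/setU1P => [->|/XP[_ /lt_asym//]]; rewrite asym_irreflexive.
have in_X x y : x \in v |: X -> y \in v |: X -> lt x y -> y \in X.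
  by move=> xX /setU1P[->|//]; rewrite (negPf (not_lt_v x xX)).
apply: (freeS (v |: X)).
- by apply/subsetP=> y /setU1P[->//|/XP[]].
- rewrite cardsU1 cardX; suff -> : v \notin X by [].
  by apply/negP => /XP[_]; rewrite asym_irreflexive.
split=> [x y xvX yvX xy|x y z xvX yvX zvX xy yz].
  have yX := in_X _ _ xvX yvX xy; case/setU1P: xvX xy => [-> _|xX xy].
    by have [] := XP y yX.
  by have /andP[] := PX x y xX yX xy.
have [yX zX] : y \in X /\ z \in X by split; [apply: in_X xy|apply: in_X yz].
case/setU1P: xvX xy => [-> _|xX xy]; last exact: (descX x y z).
have [_ _ _] := XP y yX; apply: le_trans.
by have /andP[] := PX y z yX zX yz.
Qed.

End DescendingCliques.

(* Reversing both the vertex order and the label order exchanges upper and lower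
   neighbourhoods and preserves descending cliques. *)
Lemma clique_free_rev (T : finType) (L : Type) (lt : rel T) (le : rel L)
    (l : T -> T -> L) (P : pred L) (t : nat) (S : {set T}) :
  clique_free lt le l P t S ->
  clique_free [rel x y | lt y x] [rel i j | le j i] (fun x y => l y x) P t S.
Proof.
move=> freeS X XS cardX [PX descX]; apply: (freeS X XS cardX).
split=> [x y xX yX|x y z xX yX zX xy yz]; first exact: PX.
exact: (descX z y x).
Qed.

Lemma clique_free_lower_nbhd (T : finType) (L : Type) (lt : rel T) (le : rel L)
    (l : T -> T -> L) (P : pred L) (c : L) (t : nat) (S : {set T}) (v : T) :
  asymmetric lt -> transitive le -> v \in S ->
  clique_free lt le l P t.+1 S ->
  clique_free lt le l [pred i | P i && le c i] t (lower_nbhd lt le l P c S v).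
Proof.
move=> lt_asym le_trans vS /clique_free_rev freeS.
apply: (clique_free_rev (clique_free_upper_nbhd _ _ vS freeS)).
- by move=> x y /lt_asym.
- by move=> i j k ji ik; apply: le_trans ik ji.
Qed.

Lemma leq_card_semicomplete (T : finType) (S : {set T}) (f : T -> {set T})
    (B : nat) :
  {in S &, forall x y, x != y -> (y \in f x) || (x \in f y)} ->
  {in S, forall x, #|f x| <= B} -> #|S| <= B.*2.+1.
Proof.
move=> f_total f_leq; have [->//|S_gt0] := posnP #|S|.
pose g y := [set x in S | y \in f x].
have sum_g : \sum_(y in S) #|g y| <= #|S| * B.
  under eq_bigr do rewrite -sum1dep_card.
  rewrite (exchange_big_dep (mem S)) /=; last by move=> y x _ /andP[].
  rewrite -sum_nat_const; apply: leq_sum => x xS.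
  rewrite sum1dep_card; apply: leq_trans (f_leq x xS); apply: subset_leq_card.
  by apply/subsetP => y /[!inE] /and3P[].
have sum_fg : #|S| * #|S|.-1 <= \sum_(x in S) (B + #|g x|).
  rewrite -sum_nat_const; apply: leq_sum => x xS.
  have -> : #|S|.-1 = #|S :\ x| by rewrite [in LHS](cardsD1 x) xS.
  have sub : S :\ x \subset f x :|: g x.
    apply/subsetP => y; rewrite !inE => /andP[yx yS].
    by rewrite yS f_total // eq_sym.
  apply: leq_trans (subset_leq_card sub) _.
  by apply: leq_trans (leq_card_setU _ _) _; rewrite leq_add2r f_leq.
move: sum_fg; rewrite big_split /= sum_nat_const => sum_fg.
rewrite -(leq_pmul2l S_gt0); nia.
Qed.

Section BlockSystems.
Variables (T : finType) (lt : rel T) (l : T -> T -> nat).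
Hypothesis lt_asym : asymmetric lt.
Hypothesis lt_total : forall x y, x != y -> lt x y || lt y x.

(* The block [(a, e, t)] stands for the assertion that no descending clique on
   [t.+2] vertices has all its labels in [[a, a + 2 ^ e)]. *)
Definition block : Type := nat * nat * nat.
Implicit Types (b : block) (s r : seq block) (S : {set T}).

Definition block_labels b : pred nat :=
  let: (a, e, _) := b in fun m => a <= m < a + 2 ^ e.
Definition block_mid b : nat := let: (a, e, _) := b in a + (2 ^ e)./2.
Definition block_free S b : Prop :=
  clique_free lt leq l (block_labels b) b.2.+2 S.

(* An upper bound for the number of replacements that a block can cause. *)
Definition block_weight b : nat := let: (_, e, t) := b in (e.+2 ^ t).-1.

Definition block_nbhd (upper : bool) S b v : {set T} :=
  (if upper then @upper_nbhd else @lower_nbhd)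
    T nat lt leq l (block_labels b) (block_mid b) S v.

Definition block_system S s : Prop :=
  {in S &, forall x y, lt x y -> has (block_labels^~ (l x y)) s} /\
  {in s, forall b, block_free S b}.

(* [r] can take the place of [b] once [S] has been shrunk. *)
Definition block_refinement S b r : Prop :=
  [/\ size r <= 2, \sum_(b' <- r) block_weight b' < block_weight b,
      forall m, block_labels b m -> has (block_labels^~ m) r &
      {in r, forall b', block_free S b'}].

Lemma block_nbhd_sub u S b v : block_nbhd u S b v \subset S.
Proof. by apply/subsetP => x; case: u => /[1!inE] /andP[]. Qed.

Lemma mem_block_nbhd S b x y : x \in S -> y \in S -> lt x y ->
  block_labels b (l x y) ->
  (y \in block_nbhd true S b x) || (x \in block_nbhd false S b y).
Proof. by move=> xS yS xy bxy; rewrite !inE xS yS xy bxy; apply: leq_total. Qed.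

Lemma block_nbhd_free u S b v : v \in S -> block_free S b ->
  clique_free lt leq l
    [pred m | block_labels b m &&
              (if u then m <= block_mid b else block_mid b <= m)]
    b.2.+1 (block_nbhd u S b v).
Proof.
move=> vS freeS; case: u.
  exact: (clique_free_upper_nbhd lt_asym (@leq_trans) vS freeS).
exact: (clique_free_lower_nbhd lt_asym (@leq_trans) vS freeS).
Qed.

Lemma block_weight_halves e t :
  (e.+2 ^ t).-1 + (e.+2 ^ t.+1).-1 < (e.+3 ^ t.+1).-1.
Proof.
have : 0 < e.+2 ^ t by rewrite expn_gt0.
have : e.+2 ^ t <= e.+3 ^ t by apply: leq_expn2r.
by rewrite !expnS; move: (e.+2 ^ t) (e.+3 ^ t) => A B; nia.
Qed.

Lemma block_labels_halves a e t1 t2 t m : block_labels (a, e.+1, t) m ->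
  has (block_labels^~ m) [:: (a, e, t1); (a + 2 ^ e, e, t2)].
Proof. rewrite /= expnS; lia. Qed.

Lemma block_refinement_exists u S b v : v \in S -> block_free S b ->
  0 < block_weight b -> exists r, block_refinement (block_nbhd u S b v) b r.
Proof.
case: b => [[a e] [|t]] // vS freeS _.
have freeU := block_nbhd_free (u := u) vS freeS.
have subU := block_nbhd_sub u S (a, e, t.+1) v.
move: (block_nbhd _ _ _ _) freeU subU => U freeU subU.
case: e => [|e] in freeS freeU *.
  exists [:: (a, 0, t)]; split=> //=.
  - by rewrite big_seq1 /= expnS; have := expn_gt0 2 t; lia.
  - by move=> m /=; rewrite orbF.
  move=> _ /[1!inE] /eqP->.
  by apply: clique_freeW freeU => // m /=; case: (u); lia.
have eq2 : 2 ^ e.+1 = 2 ^ e + 2 ^ e by rewrite expnS mul2n addnn.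
rewrite /= eq2 addnn doubleK in freeU; case: u freeU => freeU.
  exists [:: (a, e, t); (a + 2 ^ e, e, t.+1)]; split=> //.
  - by rewrite big_cons big_seq1; apply: block_weight_halves.
  - exact: block_labels_halves.
  move=> b; rewrite !inE => /orP[] /eqP->.
    by apply: clique_freeW freeU => // m /=; lia.
  by apply: clique_freeW freeS => // m /=; lia.
exists [:: (a, e, t.+1); (a + 2 ^ e, e, t)]; split=> //.
- by rewrite big_cons big_seq1 addnC; apply: block_weight_halves.
- exact: block_labels_halves.
move=> b; rewrite !inE => /orP[] /eqP->.
  by apply: clique_freeW freeS => // m /=; lia.
by apply: clique_freeW freeU => // m /=; lia.
Qed.

Lemma block_nbhd_eq0 u S b v : v \in S -> block_free S b ->
  block_weight b = 0 -> block_nbhd u S b v = set0.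
Proof.
case: b => [[a e] [|t]] vS freeS /= weight0.
  exact: (clique_free1_eq0 lt_asym (block_nbhd_free vS freeS)).
have : 1 < e.+2 ^ t.+1 by rewrite -{1}(exp1n t.+1) ltn_exp2r.
lia.
Qed.

Lemma block_system_refine S S' s b r : block_system S s -> b \in s ->
  S' \subset S -> block_refinement S' b r -> block_system S' (r ++ rem b s).
Proof.
move=> [cover_s free_s] bs S'S [_ _ cover_r free_r].
split=> [x y xS' yS' xy|b'].
  have := cover_s x y (subsetP S'S _ xS') (subsetP S'S _ yS') xy.
  rewrite (perm_has _ (perm_to_rem bs)) has_cat /=.
  by case/orP => [/cover_r->|->]; rewrite ?orbT.
rewrite mem_cat => /orP[/free_r//|/mem_rem/free_s].
exact: clique_freeW.
Qed.

Lemma leq_card_block_system_nbhd S s B : block_system S s ->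
  {in s & S, forall b v u, #|block_nbhd u S b v| <= B} ->
  #|S| <= 4 * (size s * B) + 1.
Proof.
move=> [cover_s _] nbhd_leq.
pose f v := \bigcup_(b <- s) (block_nbhd true S b v :|: block_nbhd false S b v).
have f_leq : {in S, forall v, #|f v| <= size s * (2 * B)}.
  move=> v vS; rewrite /f big_seq -sum1_size big_distrl [leqRHS]big_seq.
  elim/big_ind2: _ => [|C m C' m' Cm Cm'|b bs]; first by rewrite cards0.
    by apply: leq_trans (leq_card_setU _ _) (leq_add _ _).
  have nbhd_b := nbhd_leq b v bs vS.
  apply: leq_trans (leq_card_setU _ _) _.
  by apply: leq_trans (leq_add (nbhd_b true) (nbhd_b false)) _; rewrite /=; lia.
have f_lt x y : x \in S -> y \in S -> lt x y -> (y \in f x) || (x \in f y).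
  move=> xS yS xy; have /hasP[b bs bxy] := cover_s x y xS yS xy.
  rewrite /f !(perm_big _ (perm_to_rem bs)) !big_cons !in_setU.
  by case/orP: (mem_block_nbhd xS yS xy bxy) => ->; rewrite ?orbT.
have f_total : {in S &, forall x y, x != y -> (y \in f x) || (x \in f y)}.
  by move=> x y xS yS /lt_total/orP[] /f_lt; [|rewrite orbC]; apply.
by have := leq_card_semicomplete f_total f_leq; lia.
Qed.

(* A replacement adds at most one block and lowers the total weight, so [p]
   bounds the number of blocks throughout. *)
Lemma leq_card_block_system p k s S :
  \sum_(b <- s) block_weight b <= k -> size s + k <= p -> block_system S s ->
  #|S| <= (8 * p) ^ k.
Proof.
elim: k s S => [|k IH] s S weight_s size_s sys_s; have [_ free_s] := sys_s.
  have weight0 b : b \in s -> block_weight b = 0.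
    move=> bs; apply/eqP; rewrite -leqn0; apply: leq_trans weight_s.
    by rewrite (perm_big _ (perm_to_rem bs)) big_cons leq_addr.
  suff : #|S| <= 4 * (size s * 0) + 1 by rewrite !muln0.
  apply: leq_card_block_system_nbhd sys_s _ => b v bs vS u.
  by rewrite (block_nbhd_eq0 u vS (free_s b bs) (weight0 b bs)) cards0.
have nbhd_leq : {in s & S, forall b v u, #|block_nbhd u S b v| <= (8 * p) ^ k}.
  move=> b v bs vS u; have [weight0|weight_gt0] := posnP (block_weight b).
    by rewrite (block_nbhd_eq0 u vS (free_s b bs) weight0) cards0.
  have [r ref_r] := block_refinement_exists u vS (free_s b bs) weight_gt0.
  have [size_r weight_r _ _] := ref_r.
  move: weight_s size_s; rewrite (perm_big _ (perm_to_rem bs)) big_cons /=.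
  rewrite (perm_size (perm_to_rem bs)) /= => weight_s size_s.
  apply: IH (block_system_refine sys_s bs (block_nbhd_sub _ _ _ _) ref_r).
    by rewrite big_cat -ltnS; apply: leq_trans weight_s; rewrite ltn_add2r.
  apply: leq_trans size_s.
  by rewrite size_cat -addnA addSn addnS -add2n leq_add2r.
have D_gt0 : 0 < (8 * p) ^ k by rewrite expn_gt0 muln_gt0; lia.
have := leq_card_block_system_nbhd sys_s nbhd_leq.
by rewrite expnS; move: (_ ^ k) D_gt0 => D; nia.
Qed.

Lemma exists_descending_clique e t :
  (forall x y, lt x y -> l x y < 2 ^ e) ->
  (8 * e.+2 ^ t) ^ (e.+2 ^ t) < #|T| ->
  exists2 X : {set T}, #|X| = t.+2 & descending lt leq l predT X.
Proof.
move=> l_lt T_big; apply: contrapT => no_clique.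
suff : #|T| <= (8 * e.+2 ^ t) ^ (e.+2 ^ t).-1.
  move/(leq_trans T_big).
  by rewrite ltnNge leq_pexp2l ?leq_pred // muln_gt0 expn_gt0.
rewrite -cardsT; apply: (@leq_card_block_system _ _ [:: (0, e, t)]).
- by rewrite big_seq1.
- by rewrite add1n prednK // expn_gt0.
split=> [x y _ _ xy|b /[1!inE] /eqP->]; first by rewrite /= add0n l_lt.
by move=> X _ cardX [_ descX]; apply: no_clique; exists X.
Qed.

End BlockSystems.

(** * Ordered copies *)

Lemma increasing_inj m N (f : 'I_m -> 'I_N) :
  {homo f : i j / i < j} -> injective f.
Proof. by move=> f_incr; apply/inc_inj/le_mono. Qed.

Lemma enum_val_increasing N (V : {set 'I_N}) :
  {homo @Order.enum_val _ _ (mem V) : i j / i < j}.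
Proof.
have enum_val_mono := leW_mono (@Order.le_enum_val _ 'I_N le_total V).
by move=> i j; have := enum_val_mono i j; rewrite !ltEord => ->.
Qed.

Lemma mono_copy_complete k N (chi : {set 'I_N} -> bool) color (X : {set 'I_N}) :
  (forall e : {set 'I_N}, e \subset X -> #|e| = k -> chi e = color) ->
  mono_copy (complete_hypergraph k #|X|) chi color.
Proof.
move=> chi_X; exists Order.enum_val.
split=> /= [|e /[1!inE] /eqP card_e]; first exact: enum_val_increasing.
apply: chi_X.
  by apply/subsetP => _ /imsetP[i _ ->]; apply: Order.enum_valP.
by rewrite card_imset //; apply: Order.enum_val_inj.
Qed.

Lemma imset_path_edge (T : finType) (g : nat -> T) k n i : i + k <= n ->
  [set g j | j : 'I_n in path_edge k n i] = [set:: [seq g j | j <- iota i k]].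
Proof.
move=> ik_n; apply/setP => x; rewrite inE; apply/imsetP/mapP => [[j]|[j]].
  by rewrite inE => jk ->; exists (val j); rewrite ?mem_iota.
rewrite mem_iota => jk ->; have jn : j < n by lia.
by exists (Ordinal jn); rewrite ?inE.
Qed.

Lemma mono_copy_path k n N (chi : {set 'I_N} -> bool) color (g : nat -> 'I_N) :
  (forall i, i.+1 < n -> g i < g i.+1) ->
  (forall i, i + k <= n -> chi [set:: [seq g j | j <- iota i k]] = color) ->
  mono_copy (monotone_path k n) chi color.
Proof.
move=> g_incr chi_g; exists (fun i => g i); split=> /= [i j|e /imsetP[i]].
  have : j < n by []; elim: (val j) => // m IH mn; rewrite ltnS leq_eqVlt.
  case/orP => [/eqP->|/(IH (ltnW mn)) gim]; first exact: g_incr.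
  exact: ltn_trans gim (g_incr m mn).
by rewrite inE => ik_n ->; rewrite imset_path_edge ?chi_g.
Qed.

Definition mono_copy_in k N (V : {set 'I_N}) (G : ordered_hypergraph k)
    (chi : {set 'I_N} -> bool) (color : bool) : Prop :=
  exists f : 'I_(nb_vertices G) -> 'I_N,
    [/\ {homo f : i j / i < j}, forall i, f i \in V &
        forall e, e \in edges G -> chi (f @: e) = color].

Lemma ordered_arrow_restrict k (G H : ordered_hypergraph k) N (V : {set 'I_N})
    (chi : {set 'I_N} -> bool) : ordered_arrow G H #|V| ->
  mono_copy_in V G chi true \/ mono_copy_in V H chi false.
Proof.
move=> arrow; pose g (i : 'I_#|V|) : 'I_N := Order.enum_val i.
have transfer (F : ordered_hypergraph k) color :
    mono_copy F (fun A => chi (g @: A)) color -> mono_copy_in V F chi color.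
  move=> [f [f_incr chi_f]]; exists (g \o f); split=> [i j ij|i|e eF].
  - by apply: enum_val_increasing; apply: f_incr.
  - exact: Order.enum_valP.
  - by rewrite imset_comp chi_f.
by have [/transfer|/transfer] := arrow (fun A => chi (g @: A)); [left|right].
Qed.

Lemma ordered_arrowW k (G H : ordered_hypergraph k) M N :
  M <= N -> ordered_arrow G H M -> ordered_arrow G H N.
Proof.
move=> MN; have card_V : #|widen_ord MN @: [set: 'I_M]| = M.
  by rewrite card_imset ?cardsT ?card_ord //; apply: increasing_inj.
rewrite -{1}card_V => arrow chi.
by have [[f [f_incr _ chi_f]]|[f [f_incr _ chi_f]]] :=
  ordered_arrow_restrict chi arrow; [left|right]; exists f.
Qed.

Lemma ordered_ramsey_exists k (G H : ordered_hypergraph k) M :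
  ordered_arrow G H M -> exists2 N, is_ordered_ramsey G H N & N <= M.
Proof.
move=> arrow_M.
have ex_arrow : exists N, `[< ordered_arrow G H N >] by exists M; apply/asboolP.
have [N /asboolP arrow_N N_min] := ex_minnP ex_arrow.
by exists N; [split=> // N'|]; move=> *; apply/N_min/asboolP.
Qed.

(** * Triple systems *)

Lemma card3_sorted N (e : {set 'I_N}) : #|e| = 3 ->
  exists x y z : 'I_N, [/\ x < y, y < z & e = [set:: [:: x; y; z]]].
Proof.
rewrite Order.cardE => size_e; have := Order.set_enum e.
have : sorted <%O (Order.enum e) by rewrite sort_lt_sorted enum_uniq.
case: (Order.enum e) size_e => [|x [|y [|z []]]] //= _ /and3P[xy yz _] e_xyz.
by exists x, y, z.
Qed.

Section BlueTails.
Variables (N : nat) (chi : {set 'I_N} -> bool).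
Implicit Types (j n : nat) (w x y : 'I_N).

(* There is a blue tight path on [j.+2] vertices ending in [x], [y]. *)
Fixpoint blue_tail j x y : bool :=
  (x < y) &&
  match j with
  | 0 => true
  | j'.+1 => [exists w, ~~ chi [set:: [:: w; x; y]] && blue_tail j' w x]
  end.

Lemma blue_tail_path j x y : blue_tail j x y ->
  exists g : nat -> 'I_N,
  [/\ g j = x, g j.+1 = y, forall i, i <= j -> g i < g i.+1 &
      forall i, i < j -> chi [set:: [:: g i; g i.+1; g i.+2]] = false].
Proof.
elim: j x y => [|j IH] x y /= /andP[xy].
  by move=> _; exists (fun i => if i is 0 then x else y); split=> // -[].
case/existsP => w /andP[/negbTE blue_wxy /IH [g [gj gj1 g_incr g_blue]]].
exists (fun i => if i <= j.+1 then g i else y).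
split=> [||i|i] /=; rewrite ?leqnn ?ltnn //.
  by case: (ltngtP i j.+1) => // [i_lt|->] _; rewrite ?gj1 ?g_incr.
rewrite !ltnS => ij; rewrite ij (leqW ij).
by case: (ltngtP i j) ij => // [ij|->] _; rewrite ?g_blue ?gj ?gj1.
Qed.

Lemma blue_tail_copy n x y :
  blue_tail n x y -> mono_copy (monotone_path 3 n.+2) chi false.
Proof.
case/blue_tail_path => g [_ _ g_incr g_blue].
apply: (mono_copy_path (g := g)) => [i /g_incr//|i i_le].
by apply: g_blue; lia.
Qed.

(* The number of vertices of a longest blue tight path ending in [x], [y], minus
   one, as long as that path has at most [n.+1] vertices. *)
Definition tail_length n x y : nat := \sum_(j < n) blue_tail j x y.

Lemma leq_tail_length n x y : tail_length n x y <= n.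
Proof.
rewrite -[leqRHS]card_ord -sum1_card.
by apply: leq_sum => j _; apply: leq_b1.
Qed.

Lemma tail_length_lt n w x y : w < x -> x < y -> ~~ blue_tail n w x ->
  ~~ chi [set:: [:: w; x; y]] -> tail_length n.+1 w x < tail_length n.+1 x y.
Proof.
move=> wx xy /negbTE no_tail blue_wxy.
rewrite /tail_length big_ord_recr /= no_tail addn0.
rewrite big_ord_recl /= xy add1n ltnS.
apply: leq_sum => j _; case tail_wx: (blue_tail j w x) => //=; rewrite lt0b.
by apply/existsP; exists w; rewrite blue_wxy.
Qed.

End BlueTails.

Lemma ordered_arrow_triples e t n N : 1 < n <= 2 ^ e ->
  (8 * e.+2 ^ t) ^ (e.+2 ^ t) < N ->
  ordered_arrow (complete_hypergraph 3 t.+2) (monotone_path 3 n) N.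
Proof.
case: n => [|[|n]] // n_le N_big chi.
have [|no_blue] := EM (mono_copy (monotone_path 3 n.+2) chi false).
  by right.
left; pose len (x y : 'I_N) := tail_length chi n.+1 x y.
have [|x y xy|||X card_X [_ descX]] :=
  @exists_descending_clique _ (fun x y : 'I_N => x < y) len _ _ e t.
- by move=> x y; rewrite -leqNgt => /ltnW.
- by rewrite -neq_ltn.
- by move=> x y _; apply: leq_ltn_trans (leq_tail_length _ _ _ _) _.
- by rewrite card_ord.
rewrite -card_X; apply: mono_copy_complete => f fX.
case/card3_sorted => [x [y [z [xy yz fE]]]].
have [xX yX zX] : [/\ x \in X, y \in X & z \in X].
  by split; apply: (subsetP fX); rewrite fE !inE eqxx ?orbT.
apply: contraTT (descX x y z xX yX zX xy yz); rewrite fE -ltnNge => blue_xyz.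
by apply: tail_length_lt => //; apply/negP => /blue_tail_copy.
Qed.

(** * The Erdos-Rado step *)

Lemma leq_bin_exp n k : 'C(n, k) <= n ^ k.
Proof.
elim: k n => [|k IH] n; first by rewrite bin0.
apply: (@leq_trans (k.+1 * 'C(n, k.+1))); first exact: leq_pmull.
rewrite -mul_bin_diag expnS leq_mul2l; apply/orP; right.
exact: leq_trans (IH _) (leq_expn2r _ (leq_pred n)).
Qed.

Lemma pigeonhole_set (T F : finType) (S : {set T}) (f : T -> F) (P : {set F}) :
  {in S, forall x, f x \in P} ->
  exists S' : {set T}, [/\ S' \subset S, {in S' &, forall x y, f x = f y} &
    #|S| <= #|P| * #|S'|].
Proof.
move=> fP; have [->|[x0 x0S]] := set_0Vmem S.
  by exists set0; split; rewrite ?cards0 // => x; rewrite inE.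
pose fiber c := [set x in S | f x == c].
have [c cP fiber_max] :=
  @arg_maxnP _ (f x0) (mem P) (fun c => #|fiber c|) (fP _ x0S).
exists (fiber c); split.
- by apply/subsetP => x /[1!inE] /andP[].
- by move=> x y /[!inE] /andP[_ /eqP->] /andP[_ /eqP->].
rewrite -sum1_card (partition_big f (mem P)) //= -sum_nat_const.
apply: leq_sum => d dP; apply: leq_trans (fiber_max d dP).
by rewrite sum1_card; apply: subset_leq_card; apply/subsetP => x; rewrite !inE.
Qed.

Section ErdosRado.
Variables (N k : nat) (chi : {set 'I_N} -> bool).
Implicit Types (A S V : {set 'I_N}) (x y v : 'I_N).

Definition strict_ub A x : bool := [forall a in A, a < x].

Definition end_homogeneous V S : Prop :=
  forall A, A \subset V -> #|A| = k ->
  {in V :|: S &, forall x y, strict_ub A x -> strict_ub A y ->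
     chi (x |: A) = chi (y |: A)}.

Lemma end_homogeneous_step V S :
  {in V & S, forall v x, v < x} -> end_homogeneous V S -> 0 < #|S| ->
  exists v S', [/\ v \notin V, {in v |: V & S', forall u x : 'I_N, u < x},
    end_homogeneous (v |: V) S' & #|S|.-1 <= 2 ^ (#|V|.+1 ^ k) * #|S'|].
Proof.
move=> VS hom /card_gt0P[x0 x0S].
have [v vS v_min] : exists2 v, v \in S & {in S, forall x : 'I_N, v <= x}.
  by have [v] := @arg_minnP _ x0 (mem S) val x0S; exists v.
have vV : v \notin V by apply/negP => /VS /(_ vS); rewrite ltnn.
pose subsets := [set A : {set 'I_N} | A \subset v |: V & #|A| == k].
pose colors x := [set A in subsets | chi (x |: A)].
have [|S' [S'S S'_colors S'_big]] :=
  @pigeonhole_set _ _ (S :\ v) colors (powerset subsets).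
  by move=> x _; rewrite inE; apply/subsetP => A /[1!inE] /andP[].
have S'P x : x \in S' -> v < x /\ x \in S.
  move=> /(subsetP S'S) /setD1P[xv xS]; split=> //.
  by rewrite ltn_neqAle eq_sym xv v_min.
exists v, S'; split=> //.
- by move=> u x /setU1P[->|uV] /S'P[vx xS] //; apply: VS.
- move=> A AvV card_A x y xvVS yvVS Ax Ay; have [vA|vA] := boolP (v \in A).
    have in_S' z : z \in (v |: V) :|: S' -> strict_ub A z -> z \in S'.
      move=> + /forall_inP /(_ v vA) vz; rewrite -setUA !inE.
      case/or3P => // [/eqP zv|/VS/(_ vS)]; first by rewrite zv ltnn in vz.
      by rewrite ltnNge ltnW.
    have /setP/(_ A) := S'_colors x y (in_S' x xvVS Ax) (in_S' y yvVS Ay).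
    by rewrite !inE AvV card_A eqxx.
  have AV : A \subset V by rewrite -(setU1K vV) subsetD1 AvV.
  have in_VS z : z \in (v |: V) :|: S' -> z \in V :|: S.
    rewrite -setUA => /setU1P[->|/setUP[zV|/S'P[_ zS]]];
      by rewrite inE ?vS ?zV ?zS ?orbT.
  by apply: (hom A AV card_A) => //; apply: in_VS.
have -> : #|S|.-1 = #|S :\ v| by rewrite [in LHS](cardsD1 v) vS.
apply: leq_trans S'_big _; rewrite leq_mul2r card_powerset leq_exp2l //.
by rewrite cards_draws cardsU1 vV leq_bin_exp orbT.
Qed.

Lemma end_homogeneous_extend M j V S :
  {in V & S, forall v x, v < x} -> end_homogeneous V S -> #|V| + j <= M ->
  (2 * 2 ^ (M ^ k)) ^ j <= #|S| ->
  exists2 V' : {set 'I_N}, #|V'| = #|V| + j & end_homogeneous V' set0.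
Proof.
elim: j V S => [|j IH] V S VS hom VM S_big.
  exists V; first by rewrite addn0.
  move=> A AV card_A x y; rewrite setU0 => xV yV.
  by apply: (hom A AV card_A); rewrite inE ?xV ?yV.
have S_gt0 : 0 < #|S|.
  by apply: leq_trans S_big; rewrite expn_gt0 muln_gt0 expn_gt0.
have [v [S' [vV vVS' hom' S'_big]]] := end_homogeneous_step VS hom S_gt0.
have card_vV : #|v |: V| = #|V|.+1 by rewrite cardsU1 vV.
rewrite addnS -addSn -card_vV in VM *; apply: (IH _ _ vVS' hom' VM).
have weight_le : 2 ^ (#|V|.+1 ^ k) <= 2 ^ (M ^ k).
  by rewrite leq_exp2l // leq_expn2r // -card_vV (leq_trans _ VM) ?leq_addr.
have weight_gt0 : 0 < 2 ^ (M ^ k) by rewrite expn_gt0.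
move: S_big S'_big weight_le weight_gt0; rewrite expnS.
move: (2 ^ (M ^ k)) (2 ^ (#|V|.+1 ^ k)) ((2 * _) ^ j) #|S| #|S'| => W w B a b.
move=> a_big b_big wW W_gt0; rewrite leqNgt; apply/negP => b_lt.
have : w * b <= W * b by rewrite leq_mul2r wW orbT.
have : W * b.+1 <= W * B by rewrite leq_mul2l b_lt orbT.
nia.
Qed.

Definition end_coloring V A : bool :=
  [exists x in V, strict_ub A x && chi (x |: A)].

Lemma end_coloringE V A x : end_homogeneous V set0 -> A \subset V -> #|A| = k ->
  x \in V -> strict_ub A x -> chi (x |: A) = end_coloring V A.
Proof.
move=> hom AV card_A xV Ax.
apply/idP/exists_inP => [chi_x|[y yV /andP[Ay chi_y]]].
  by exists x; rewrite // Ax.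
by rewrite (hom A AV card_A x y) // setU0.
Qed.

Lemma imset_end_coloring V n (f : 'I_n -> 'I_N) (e : {set 'I_n}) (z : 'I_n) :
  end_homogeneous V set0 -> {homo f : i j / i < j} -> (forall i, f i \in V) ->
  #|e| = k -> {in e, forall i : 'I_n, i < z} ->
  chi (f @: (z |: e)) = end_coloring V (f @: e).
Proof.
move=> hom f_incr fV card_e e_lt; rewrite imsetU1; apply: end_coloringE => //.
- by apply/subsetP => _ /imsetP[i _ ->].
- by rewrite card_imset //; apply: increasing_inj.
by apply/forall_inP => _ /imsetP[i /e_lt iz ->]; apply: f_incr.
Qed.

Lemma mono_copy_complete_end V s color : end_homogeneous V set0 ->
  mono_copy_in V (complete_hypergraph k s) (end_coloring V) color ->
  mono_copy (complete_hypergraph k.+1 s) chi color.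
Proof.
move=> hom [f [f_incr fV f_color]]; exists f; split=> //= e.
move=> /[1!inE] /eqP card_e.
have /card_gt0P[i0 i0e] : 0 < #|e| by rewrite card_e.
have [z ze z_max] : exists2 z, z \in e & {in e, forall i : 'I_s, i <= z}.
  by have [z] := @arg_maxnP _ i0 (mem e) val i0e; exists z.
have card_ez : #|e :\ z| = k by have := cardsD1 z e; rewrite card_e ze => -[].
rewrite -(setD1K ze) (imset_end_coloring hom) ?f_color ?inE ?card_ez //.
by move=> i /setD1P[iz ie]; rewrite ltn_neqAle iz z_max.
Qed.

Lemma mono_copy_path_end V n color : end_homogeneous V set0 ->
  mono_copy_in V (monotone_path k n) (end_coloring V) color ->
  mono_copy (monotone_path k.+1 n) chi color.
Proof.
move=> hom [f [f_incr fV f_color]]; exists f; split=> //= e.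
case/imsetP => i /[1!inE] ik_n ->.
have ik_lt : i + k < n by rewrite -addnS.
have edge_i : path_edge k n i \in path_edges k n.
  by apply/imsetP; exists i; rewrite // inE ltnW.
have -> : path_edge k.+1 n i = Ordinal ik_lt |: path_edge k n i.
  by apply/setP => j; rewrite !inE -val_eqE /=; lia.
rewrite (imset_end_coloring hom) ?f_color ?(path_edges_uniform edge_i) //.
by move=> j /[1!inE] /andP[].
Qed.

End ErdosRado.

Lemma ordered_arrow_stepup k s n M N : 0 < k -> (2 * 2 ^ (M ^ k)) ^ M <= N ->
  ordered_arrow (complete_hypergraph k s) (monotone_path k n) M ->
  ordered_arrow (complete_hypergraph k.+1 s) (monotone_path k.+1 n) N.
Proof.
move=> k_gt0 N_big arrow chi.
have [||||V] := @end_homogeneous_extend N k chi M M set0 [set: 'I_N].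
- by move=> v x; rewrite inE.
- by move=> A; rewrite subset0 => /eqP->; rewrite cards0; lia.
- by rewrite cards0.
- by rewrite cardsT card_ord.
rewrite cards0 add0n => card_V hom; rewrite -card_V in arrow.
have [red|blue] := ordered_arrow_restrict (end_coloring chi V) arrow.
  by left; apply: mono_copy_complete_end red.
by right; apply: mono_copy_path_end blue.
Qed.

(** * Tower bounds *)

Definition tower j x : nat := iter j (expn 2) x.

Lemma leq_tower j x y : x <= y -> tower j x <= tower j y.
Proof. by move=> xy; elim: j => //= j IH; rewrite leq_exp2l. Qed.

Lemma tower_ge j x : x <= tower j x.
Proof. by elim: j => //= j IH; apply: leq_trans IH (ltnW (ltn_expl _ _)). Qed.

Lemma tower_expn j x m : 1 < x -> 0 < m -> tower j x ^ m <= tower j (x ^ m).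
Proof.
move=> x_gt1; case: m => // m _; elim: j => //= j IH.
rewrite -expnM leq_exp2l //; apply: leq_trans IH; rewrite expnS.
have tower_gt1 := leq_trans x_gt1 (tower_ge j x).
by rewrite leq_mul // ltn_expl.
Qed.

(* Stepping up from [k] multiplies the exponent at the bottom of the tower by
   [k + 2], hence the factorial. *)
Lemma ordered_arrow_tower s e n j : 1 < s -> 1 < n <= 2 ^ e ->
  ordered_arrow (complete_hypergraph (j + 3) s) (monotone_path (j + 3) n)
    (tower j (2 ^ ((s + 2) * (j + 4)`! * e.+2 ^ s.-1))).
Proof.
case: s => [|[|t]] // _ n_le; elim: j => [|j IH].
  apply: (ordered_arrow_triples n_le) => /=.
  have r_gt0 : 0 < e.+2 ^ t by rewrite expn_gt0.
  have r_le : e.+2 ^ t <= 2 ^ (e.+2 * t).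
    by rewrite expnM leq_expn2r // ltnW // ltn_expl.
  have base_le : 8 * e.+2 ^ t <= 2 ^ (3 + e.+2 * t) by rewrite expnD leq_mul.
  apply: leq_ltn_trans (leq_expn2r _ base_le) _.
  rewrite -expnM ltn_exp2l // expnS add0n (_ : 4`! = 24) // mulnA ltn_pmul2r //.
  nia.
rewrite [j.+1 + 3]addSn; apply: ordered_arrow_stepup IH; first by lia.
set x := 2 ^ (_ * (j + 4)`! * _); set M := tower j x.
have x_gt1 : 1 < x.
  by rewrite -{1}(expn0 2) ltn_exp2l // !muln_gt0 fact_gt0 expn_gt0.
have M_gt1 : 1 < M := leq_trans x_gt1 (tower_ge j x).
rewrite /= expnMn -expnM -expnD leq_exp2l //; apply: (@leq_trans (M ^ (j + 5))).
  have -> : j + 5 = (j + 3).+2 by lia.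
  have : 0 < M ^ (j + 3) by rewrite expn_gt0 ltnW.
  by rewrite !expnS; move: (M ^ _) => P; nia.
apply: leq_trans (tower_expn j x_gt1 (_ : 0 < j + 5)) _; first by lia.
rewrite -expnM; apply: leq_tower; rewrite leq_exp2l //.
have -> : (j.+1 + 4)`! = (j + 5) * (j + 4)`! by rewrite addSn factS (addnS j 4).
by rewrite mulnAC leq_mul2r -mulnA [(j + 5) * _]mulnC leqnn orbT.
Qed.

Lemma ordered_arrow_small k s n : s < k ->
  ordered_arrow (complete_hypergraph k s) (monotone_path k n) s.
Proof.
move=> sk chi; left; exists id; split=> //= e /[1!inE] /eqP card_e.
by have := max_card (mem e); rewrite card_e card_ord leqNgt sk.
Qed.

(* The factor [s] is for the case [s = 0], where the exponent [s - 1] of the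
   logarithm is negative. *)
Definition ramsey_const s : nat := s * (s + 2)`! * 4 ^ s.

Lemma ordered_arrow_complete_path k s n : 2 < k -> 1 < n ->
  ordered_arrow (complete_hypergraph k s) (monotone_path k n)
    (tower (k - 3) (2 ^ (ramsey_const s * trunc_log 2 n ^ s.-1))).
Proof.
move=> k_gt2 n_gt1; set log_n := trunc_log 2 n.
have log_gt0 : 0 < log_n by rewrite trunc_log_gt0.
have [sk|ks] := ltnP s k.
  apply: ordered_arrowW (ordered_arrow_small n sk).
  apply: leq_trans (tower_ge _ _).
  apply: ltnW (leq_trans (ltn_expl s (isT : 1 < 2)) _).
  rewrite leq_exp2l // /ramsey_const -!mulnA leq_pmulr // !muln_gt0.
  by rewrite fact_gt0 !expn_gt0 log_gt0.
have n_le : 1 < n <= 2 ^ log_n.+1 by rewrite n_gt1 ltnW // trunc_log_ltn.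
have s_gt1 : 1 < s by lia.
have [j kE] : exists j, k = j + 3 by exists (k - 3); lia.
rewrite {}kE addnK in ks *.
apply: (ordered_arrowW _ (ordered_arrow_tower s_gt1 n_le)).
apply: leq_tower; rewrite leq_exp2l // /ramsey_const.
have fact_le : (s + 2) * (j + 4)`! <= s * (s + 2)`!.
  apply: (@leq_trans ((s + 2) * (s.+1)`!)).
    by rewrite leq_mul ?leq_fact //; lia.
  by rewrite addn2 -factS leq_pmull //; lia.
have log_le : log_n.+3 ^ s.-1 <= 4 ^ s * log_n ^ s.-1.
  apply: (@leq_trans ((4 * log_n) ^ s.-1)); first by apply: leq_expn2r; lia.
  by rewrite expnMn leq_mul2r leq_exp2l // leq_pred orbT.
by rewrite -[leqRHS]mulnA leq_mul.
Qed.

Local Open Scope ring_scope.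

Lemma natr_tower (R : realType) j x : (tower j x)%:R = twr j.+1 x%:R :> R.
Proof. by rewrite /twr; elim: j => //= j <-; rewrite powR_mulrn // natrX. Qed.

Lemma ler_twr (R : realType) j (x y : R) : x <= y -> twr j x <= twr j y.
Proof.
by rewrite /twr => xy; elim: (_.-1) => //= i IH; rewrite ler_powR ?ler1n.
Qed.

Lemma trunc_log_le_log2 (R : realType) n : (0 < n)%N ->
  (trunc_log 2 n)%:R <= log2 n%:R :> R.
Proof.
move=> n_gt0; have ln2_gt0 : 0 < ln 2 :> R by rewrite ln_gt0 // ltr1n.
rewrite /log2 ler_pdivlMr // mulr_natl -lnXn //.
by rewrite ler_ln ?posrE ?exprn_gt0 ?ltr0n // -natrX ler_nat trunc_logP.
Qed.

Lemma ramsey_const_exponent_le (R : realType) s n : (1 < n)%N ->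
  (ramsey_const s * trunc_log 2 n ^ s.-1)%:R <=
  (ramsey_const s)%:R * log2 n%:R ^ (s%:Z - 1) :> R.
Proof.
move=> n_gt1; case: s => [|s]; first by rewrite !mul0r.
rewrite -[s.+1%:Z - 1]/(Posz s.+1 - 1%:Z) subzn // subn1 natrM natrX.
rewrite ler_wpM2l //.
have log_le := trunc_log_le_log2 R (ltnW n_gt1).
by rewrite lerXn2r ?nnegrE // (le_trans _ log_le).
Qed.

Theorem theorem1p3 (R : realType) (s : nat) :
  exists c : R, forall k n : nat, (3 <= k)%N -> (2 <= n)%N ->
    exists N : nat,
      is_ordered_ramsey (complete_hypergraph k s) (monotone_path k n) N /\
      N%:R <= twr (k - 2) (2 `^ (c * log2 n%:R ^ (s%:Z - 1))).
Proof.
exists (ramsey_const s)%:R => k n k_ge3 n_ge2.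
have [N ramsey_N N_le] :=
  ordered_ramsey_exists (@ordered_arrow_complete_path k s n k_ge3 n_ge2).
exists N; split=> //; move: N_le; rewrite -(ler_nat R) natr_tower => N_le.
apply: le_trans N_le _; have -> : (k - 2 = (k - 3).+1)%N by lia.
apply: ler_twr; rewrite natrX -powR_mulrn //.
by rewrite ler_powR ?ler1n // ramsey_const_exponent_le.
Qed.
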